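(* Let $G$ be a linearly ordered group. Let $S$ be either $\mathscr{B}(G)$ or $\mathscr{B}^+(G)$, and let $\mathfrak{C}_{mg}$ be the least group congruence on $S$. Then the quotient semigroup $S/\mathfrak{C}_{mg}$ is antiisomorphic to the group $G$.
   Context: A linearly ordered group is a group $G$ (identity $e$) with a total order $\leqslant$ such that $a\leqslant b$ implies $ag\leqslant bg$ and $ga\leqslant gb$ for all $a,b,g\in G$; $G^+=\{x\in G: e\leqslant x\}$. For $g,h\in G$, $\alpha^g_h$ is the partial map $G\rightharpoonup G$ with domain $\{x\in G: g\leqslant x\}$ given by $(x)\alpha^g_h=x g^{-1}h$. Put $\mathscr{B}(G)=\{\alpha^g_h: g,h\in G\}$ and $\mathscr{B}^+(G)=\{\alpha^g_h: g,h\in G^+\}$; these are inverse semigroups under composition of partial maps (maps written on the right, $x(\alpha\beta)=(x\alpha)\beta$ for $x\in\operatorname{dom}\alpha$ with $x\alpha\in\operatorname{dom}\beta$); explicitly $\alpha^g_h\cdot\alpha^k_l=\alpha^a_b$ with $a=(h\vee k)h^{-1}g$, $b=(h\vee k)k^{-1}l$, where $\vee$ is maximum. A group congruence on a semigroup is a congruence whose quotient is a group; every inverse semigroup $S$ has a least group congruence, given by $a\mathfrak{C}_{mg}b$ iff $a\varepsilon=b\varepsilon$ for some idempotent $\varepsilon\in S$. An antiisomorphism is a bijection $h$ with $(a\cdot b)h=(b)h\cdot(a)h$. *)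

(* Defs.v *)
From HB Require Import structures.
From mathcomp Require Import all_boot all_order.
From mathcomp Require Import mathcomp_extra boolp.

Set Implicit Arguments.
Unset Strict Implicit.
Unset Printing Implicit Defensive.

Import Order.TTheory.
Local Open Scope order_scope.
Local Open Scope group_scope.
Local Open Scope quotient_scope.

HB.mixin Record isLinearlyOrderedGroup d G of Group G & Order.Total d G := {
  leg_mulr : forall g a b : G, a <= b -> a * g <= b * g;
  leg_mull : forall g a b : G, a <= b -> g * a <= g * b
}.

#[short(type="logroupType")]
HB.structure Definition LinearlyOrderedGroup d :=
  {G of isLinearlyOrderedGroup d G & Group G & Order.Total d G}.

(** Partial self-maps of [T]. Maps are written on the right: [f * g] is
    "first [f], then [g]", with domain {x in dom f | x f in dom g}. *)
Definition partial_map (T : choiceType) : Type := T -> option T.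

Section PartialMap.
Variable T : choiceType.

Definition pmap_mul (f g : partial_map T) : partial_map T :=
  fun x => obind g (f x).

Fact pmap_mulA : associative pmap_mul.
Proof. by move=> f g h; apply/funext => x; rewrite /pmap_mul; case: (f x). Qed.

HB.instance Definition _ := Choice.copy (partial_map T) (T -> option T).
HB.instance Definition _ := isSemigroup.Build (partial_map T) pmap_mulA.
End PartialMap.

Section Bicyclic.
Context {d : Order.disp_t} {G : logroupType d}.
Implicit Types g h k l x : G.

Definition alpha g h : partial_map G :=
  fun x => if g <= x then Some (x * g^-1 * h) else None.

Lemma leg_mulrE g a b : (a * g <= b * g) = (a <= b :> G).
Proof.
by apply/idP/idP => [/(leg_mulr g^-1)|/(leg_mulr g) //]; rewrite !mulgK.
Qed.

Lemma leg_mullE g a b : (g * a <= g * b) = (a <= b :> G).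
Proof.
by apply/idP/idP => [/(leg_mull g^-1)|/(leg_mull g) //]; rewrite !mulKg.
Qed.

Lemma alphaM g h k l : alpha g h * alpha k l =
  alpha (Order.max h k * h^-1 * g) (Order.max h k * k^-1 * l).
Proof.
apply/funext => x; rewrite {1}/mul /= /pmap_mul /alpha.
have -> : (Order.max h k * h^-1 * g <= x) = (g <= x) && (k <= x * g^-1 * h).
  rewrite -[LHS](leg_mulrE g^-1) mulgK -[LHS](leg_mulrE h) mulgVK ge_max.
  by rewrite -[g <= x](leg_mulrE (g^-1 * h)) !mulgA mulgV mul1g.
case: (g <= x) => //=; case: ifP => //= _; congr Some.
by rewrite !invgM invgK !mulgA !mulgVK.
Qed.

Lemma alpha_inj g h k l : alpha g h = alpha k l -> g = k /\ h = l.
Proof.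
move=> E; have := congr1 (@^~ g) E; have := congr1 (@^~ k) E.
rewrite /alpha !lexx !mulgV !mul1g; case: ifP => // gk [Eh]; case: ifP => // kg.
have gk' : g = k by apply/le_anti; rewrite gk.
by subst k; rewrite mulgV !mul1g => -[->].
Qed.

Definition bicyclic_pred : {pred partial_map G} :=
  fun f => `[< exists g h : G, f = alpha g h >].

Definition bicyclic_pos_pred : {pred partial_map G} :=
  fun f => `[< exists g h : G, [/\ 1 <= g, 1 <= h & f = alpha g h] >].

Fact bicyclic_mul_closed : mulg_closed bicyclic_pred.
Proof.
move=> _ _ /asboolP[g [h ->]] /asboolP[k [l ->]]; apply/asboolP.
by rewrite alphaM; do 2!eexists.
Qed.

Fact bicyclic_pos_mul_closed : mulg_closed bicyclic_pos_pred.
Proof.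
move=> _ _ /asboolP[g [h [g1 h1 ->]]] /asboolP[k [l [k1 l1 ->]]].
apply/asboolP; exists (Order.max h k * h^-1 * g), (Order.max h k * k^-1 * l).
rewrite alphaM; split=> //.
  apply: (le_trans g1); rewrite -{1}(mul1g g) leg_mulrE -(mulgV h) leg_mulrE.
  by rewrite le_max lexx.
apply: (le_trans l1); rewrite -{1}(mul1g l) leg_mulrE -(mulgV k) leg_mulrE.
by rewrite le_max lexx orbT.
Qed.
End Bicyclic.

Record bicyclic d (G : logroupType d) := Bicyclic {
  bicyclic_val :> partial_map G;
  bicyclicP : bicyclic_val \in bicyclic_pred
}.
HB.instance Definition _ d (G : logroupType d) :=
  [isSub for @bicyclic_val d G].
HB.instance Definition _ d (G : logroupType d) :=
  [Choice of bicyclic G by <:].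
HB.instance Definition _ d (G : logroupType d) :=
  SubChoice_isSubSemigroup.Build (partial_map G) _ (bicyclic G)
    bicyclic_mul_closed.

Record bicyclic_pos d (G : logroupType d) := BicyclicPos {
  bicyclic_pos_val :> partial_map G;
  bicyclic_posP : bicyclic_pos_val \in bicyclic_pos_pred
}.
HB.instance Definition _ d (G : logroupType d) :=
  [isSub for @bicyclic_pos_val d G].
HB.instance Definition _ d (G : logroupType d) :=
  [Choice of bicyclic_pos G by <:].
HB.instance Definition _ d (G : logroupType d) :=
  SubChoice_isSubSemigroup.Build (partial_map G) _ (bicyclic_pos G)
    bicyclic_pos_mul_closed.

(** Relations are [bool]-valued, as required by [{eq_quot _}]; with the
    classical axioms of [boolp] this covers every [Prop]-valued congruence. *)
Record congruence (S : semigroupType) := Congruence {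
  cong_rel :> equiv_rel S;
  congM : forall a b c e : S,
    cong_rel a b -> cong_rel c e -> cong_rel (a * c) (b * e)
}.

Definition quotient_semigroup (S : semigroupType) (C : congruence S) : Type :=
  {eq_quot C}.

Section Quotient.
Variables (S : semigroupType) (C : congruence S).
Local Notation Q := (quotient_semigroup C).

HB.instance Definition _ := Choice.on Q.
HB.instance Definition _ := EqQuotient.on Q.

Definition quot_mul : Q -> Q -> Q := lift_op2 Q mul.

Lemma pi_quot_mul : {morph \pi_Q : a b / a * b >-> quot_mul a b}.
Proof.
move=> a b; unlock quot_mul; apply/eqquotP; apply: congM;
  by apply/(@eqquotP _ _ Q); rewrite reprK.
Qed.

Fact quot_mulA : associative quot_mul.
Proof.
elim/quotW => a; elim/quotW => b; elim/quotW => c.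
by rewrite -!pi_quot_mul mulgA.
Qed.

HB.instance Definition _ := isSemigroup.Build Q quot_mulA.

Lemma pi_mul (a b : S) : \pi_Q (a * b) = \pi_Q a * \pi_Q b.
Proof. exact: pi_quot_mul. Qed.
End Quotient.

Definition is_group (S : semigroupType) : Prop :=
  exists e : S, (forall x : S, e * x = x /\ x * e = x) /\
                (forall x : S, exists y : S, x * y = e /\ y * x = e).

Definition group_congruence (S : semigroupType) (C : congruence S) : Prop :=
  is_group (quotient_semigroup C).

Definition least_group_congruence (S : semigroupType) (C : congruence S) :
    Prop :=
  group_congruence C /\
  forall D : congruence S, group_congruence D -> subrel C D.

Definition antiisomorphic (S T : magmaType) : Prop :=
  exists2 h : S -> T, bijective h & forall a b : S, h (a * b) = h b * h a.

(** A regular semigroup whose idempotents commute (that is, an inverse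
    semigroup) has a least group congruence. *)
Section LeastGroupCongruence.
Variables (S : semigroupType) (s0 : S).
Hypothesis regS : forall a : S, exists b : S, a * b * a = a.
Hypothesis idemC : forall e f : S, e * e = e -> f * f = f -> e * f = f * e.
Implicit Types a b c e f : S.

Let mgc : rel S := fun a b => `[< exists2 e, e * e = e & a * e = b * e >].

Let idemM e f : e * e = e -> f * f = f -> e * f * (e * f) = e * f.
Proof.
move=> ee ff.
by rewrite mulgA -(mulgA e) -(idemC ee ff) mulgA ee -mulgA ff.
Qed.

Let idemJ a b e : a * b * a = a -> e * e = e ->
  (b * e * a) * (b * e * a) = b * e * a /\ a * (b * e * a) = e * a.
Proof.
move=> aba ee; have ab : a * b * (a * b) = a * b by rewrite mulgA aba.
have E : a * (b * e * a) = e * a.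
  by rewrite !mulgA (idemC ab ee) -mulgA aba.
by split=> //; rewrite -mulgA E !mulgA -(mulgA b) ee.
Qed.

Let mgc_equiv : equiv_class_of mgc.
Proof.
split.
- move=> a; apply/asboolP; have [b aba] := regS a.
  by exists (a * b); rewrite // mulgA aba.
- by move=> a b; apply/asboolP/asboolP => -[e ee eq_e]; exists e.
- move=> b a c /asboolP[e ee abe] /asboolP[f ff bcf]; apply/asboolP.
  exists (e * f); first exact: idemM.
  by rewrite mulgA abe -mulgA (idemC ee ff) mulgA bcf -mulgA.
Qed.

Let mgc_rel := EquivRelPack mgc_equiv.

Let mgcM a b c e : mgc_rel a b -> mgc_rel c e -> mgc_rel (a * c) (b * e).
Proof.
move=> /asboolP[f ff abf] /asboolP[g gg ceg]; apply/asboolP.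
have [c' cc'c] := regS c; have [jj cj] := idemJ cc'c ff.
exists (c' * f * c * g); first exact: idemM.
rewrite {2}(idemC jj gg) -!(mulgA a) -!(mulgA b) (mulgA e) -ceg -(mulgA c).
by rewrite -(idemC jj gg) (mulgA c) cj !mulgA abf.
Qed.

Lemma least_group_congruence_exists :
  exists2 C : congruence S, least_group_congruence C &
    forall a b, C a b <-> exists2 e, e * e = e & a * e = b * e.
Proof.
pose C := Congruence mgcM; exists C; last by move=> a b; split=> /asboolP.
pose Q := quotient_semigroup C.
have CP a b : C a b -> \pi_Q a = \pi_Q b by move/(@eqquotP _ _ Q).
have [t0 e0E] := regS s0; pose e0 := s0 * t0.
have e00 : e0 * e0 = e0 by rewrite /e0 mulgA e0E.
split=> [|D [e [eP invP]] a b /asboolP[f ff abf]].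
  exists (\pi_Q e0); split; elim/quotW => a.
    split; rewrite -pi_mul; apply/CP/asboolP; last first.
      by exists e0; rewrite // -mulgA e00.
    have [b aba] := regS a; have [jj aj] := idemJ aba e00.
    by exists (b * e0 * a); rewrite // -mulgA aj mulgA e00.
  have [b aba] := regS a; exists (\pi_Q b).
  have idemP f : f * f = f -> \pi_Q f = \pi_Q e0.
    move=> ff; apply/CP/asboolP; exists (f * e0); first exact: idemM.
    by rewrite mulgA ff (idemC ff e00) mulgA e00.
  rewrite -!pi_mul; split; apply: idemP; first by rewrite mulgA aba.
  by rewrite -mulgA (mulgA a) aba.
apply/(@eqquotP _ _ (quotient_semigroup D)).
have := congr1 \pi_(quotient_semigroup D) abf; rewrite !pi_mul.
have [y [fy _]] := invP (\pi_(quotient_semigroup D) f).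
move/(congr1 (mul^~ y)); rewrite -!mulgA fy.
by rewrite !(proj2 (eP _)).
Qed.
End LeastGroupCongruence.

Section BicyclicLeast.
Context {d : Order.disp_t} {G : logroupType d}.

Let alpha_reg (g h : G) : alpha g h * alpha h g * alpha g h = alpha g h.
Proof. by rewrite !alphaM maxxx !mulgV !mul1g maxxx !mulgV !mul1g. Qed.

Let alpha_idem (g h : G) : alpha g h * alpha g h = alpha g h -> h = g.
Proof.
rewrite alphaM => /alpha_inj[Eg Eh].
have hE : Order.max h g = h.
  by apply: (mulIg h^-1); apply: (mulIg g); rewrite mulgV mul1g.
have gE : Order.max h g = g.
  by apply: (mulIg g^-1); apply: (mulIg h); rewrite mulgV mul1g.
by rewrite -hE.
Qed.

Let alpha_idemC (g h : G) : alpha g g * alpha h h = alpha h h * alpha g g.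
Proof. by rewrite !alphaM !mulgVK maxC. Qed.

Lemma bicyclic_least_exists :
  exists C : congruence (bicyclic G), least_group_congruence C.
Proof.
have inB g h : alpha g h \in @bicyclic_pred d G by apply/asboolP; exists g, h.
have [|||C lC _] := @least_group_congruence_exists (bicyclic G); last by exists C.
- exact: (Bicyclic (inB 1 1)).
- move=> [a aP]; have /asboolP[g [h Ea]] := aP; exists (Bicyclic (inB h g)).
  by apply/val_inj; rewrite !valM /= Ea alpha_reg.
- move=> [a aP] [b bP]; have /asboolP[g [h Ea]] := aP.
  have /asboolP[k [l Eb]] := bP; subst a b => /(congr1 val) + /(congr1 val).
  rewrite !valM /= => /alpha_idem Eh /alpha_idem El; apply/val_inj.
  by subst h l; rewrite !valM /= alpha_idemC.
Qed.

Lemma bicyclic_pos_least_exists :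
  exists C : congruence (bicyclic_pos G), least_group_congruence C.
Proof.
have inB g h : 1 <= g -> 1 <= h -> alpha g h \in @bicyclic_pos_pred d G.
  by move=> g1 h1; apply/asboolP; exists g, h.
have [|||C lC _] := @least_group_congruence_exists (bicyclic_pos G);
  last by exists C.
- exact: (BicyclicPos (inB 1 1 (lexx _) (lexx _))).
- move=> [a aP]; have /asboolP[g [h [g1 h1 Ea]]] := aP.
  exists (BicyclicPos (inB h g h1 g1)).
  by apply/val_inj; rewrite !valM /= Ea alpha_reg.
- move=> [a aP] [b bP]; have /asboolP[g [h [_ _ Ea]]] := aP.
  have /asboolP[k [l [_ _ Eb]]] := bP; subst a b => /(congr1 val) + /(congr1 val).
  rewrite !valM /= => /alpha_idem Eh /alpha_idem El; apply/val_inj.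
  by subst h l; rewrite !valM /= alpha_idemC.
Qed.
End BicyclicLeast.

(* Main.v *)
(** The map sending [alpha g h] to [g^-1 * h] is a surjective semigroup morphism
    onto [G], and two elements with the same image agree after right
    multiplication by the idempotent [alpha m m] with [m] large enough. Its
    kernel is a group congruence, so it contains the least one; conversely any
    group congruence has a cancellative quotient, so it contains the kernel.
    Hence the quotient is [G], and inversion turns the isomorphism into an
    antiisomorphism. *)
Require Import Defs.
From mathcomp Require Import all_boot all_order.
From mathcomp Require Import boolp.

Set Implicit Arguments.
Unset Strict Implicit.
Unset Printing Implicit Defensive.

Import Order.TTheory.
Local Open Scope order_scope.
Local Open Scope group_scope.
Local Open Scope quotient_scope.

Lemma pi_congP (S : semigroupType) (C : congruence S) (a b : S) :
  \pi_(quotient_semigroup C) a = \pi_(quotient_semigroup C) b <-> C a b.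
Proof. by split=> /(@eqquotP _ _ (quotient_semigroup C)). Qed.

(** The class of [e] is invertible in the quotient, so it cancels on the right. *)
Lemma group_congruence_cancel (S : semigroupType) (C : congruence S)
    (a b e : S) :
  group_congruence C -> a * e = b * e -> C a b.
Proof.
move=> [u [uP invP]] abe; apply/pi_congP.
have := congr1 \pi_(quotient_semigroup C) abe; rewrite !pi_mul.
have [y [ey _]] := invP (\pi_(quotient_semigroup C) e).
move/(congr1 (mul^~ y)); rewrite -!mulgA ey.
by rewrite !(proj2 (uP _)).
Qed.

Section Kernel.
Variables (S : semigroupType) (G : groupType) (phi : S -> G).
Hypothesis phiM : {morph phi : a b / a * b}.

Fact kernel_equiv : equiv_class_of (fun a b => phi a == phi b).
Proof. by split=> [a|a b|b a c /eqP ->] //; rewrite ?eqxx // eq_sym. Qed.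

Fact kernel_congM a b c e : EquivRelPack kernel_equiv a b ->
  EquivRelPack kernel_equiv c e -> EquivRelPack kernel_equiv (a * c) (b * e).
Proof. by move=> /eqP ab /eqP ce; apply/eqP; rewrite !phiM ab ce. Qed.

Definition kernel_congruence : congruence S := Congruence kernel_congM.

Hypothesis phi_surj : forall x, exists a, phi a = x.

Lemma kernel_group_congruence : group_congruence kernel_congruence.
Proof.
have [u phiu] := phi_surj 1; exists (\pi u); split; elim/quotW => a.
  by split; rewrite -pi_mul; apply/pi_congP/eqP;
    rewrite phiM phiu ?mul1g ?mulg1.
have [b phib] := phi_surj (phi a)^-1; exists (\pi b).
by rewrite -!pi_mul; split; apply/pi_congP/eqP;
  rewrite phiM phib phiu ?mulgV ?mulVg.
Qed.

Hypothesis phi_cancel : forall a b, phi a = phi b -> exists e, a * e = b * e.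

Lemma least_group_quotient_antiiso (C : congruence S) :
  least_group_congruence C -> antiisomorphic (quotient_semigroup C) G.
Proof.
move=> [gC leC]; pose Q := quotient_semigroup C.
have CE a b : \pi_Q a = \pi_Q b <-> phi a = phi b.
  split=> [/pi_congP|/phi_cancel[e abe]].
    by move/(leC _ kernel_group_congruence)/eqP.
  by apply/pi_congP; apply: group_congruence_cancel abe.
have phi_repr a : phi (repr (\pi_Q a)) = phi a by apply/CE; rewrite reprK.
have [s sK] := choice phi_surj.
(* By [CE], the choice of representative is immaterial. Taking inverses in [G] reverses products. *)
exists (fun q : Q => (phi (repr q))^-1).
  exists (fun x => \pi_Q (s x^-1)) => [|x]; last by rewrite phi_repr sK invgK.
  by elim/quotW => a; apply/CE; rewrite sK invgK phi_repr.
elim/quotW => a; elim/quotW => b.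
by rewrite -pi_mul !phi_repr phiM invgM.
Qed.
End Kernel.

Section PartialShifts.
Variables (d : Order.disp_t) (G : logroupType d).
Variables (S : semigroupType) (v : S -> partial_map G).
Hypothesis v_inj : injective v.
Hypothesis vM : {morph v : a b / a * b}.
Hypothesis v_alpha : forall a, exists g h, v a = alpha g h.
Hypothesis alpha_v :
  forall g h : G, 1 <= g -> 1 <= h -> exists a, v a = alpha g h.

(** Treats both semigroups at once, with [v] the inclusion into partial maps. Only shifts with both
    parameters at least [1] must lie in its image, and the positive semigroup contains these too. *)
Lemma shifts_least_group_quotient (C : congruence S) :
  least_group_congruence C -> antiisomorphic (quotient_semigroup C) G.
Proof.
have shiftP a : exists x, exists g h, v a = alpha g h /\ x = g^-1 * h.
  by have [g [h ah]] := v_alpha a; exists (g^-1 * h), g, h.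
have [phi phiP] := choice shiftP.
(* A shift determines its two parameters, so the chosen value does not depend on the
   presentation. *)
have phiE a g h : v a = alpha g h -> phi a = g^-1 * h.
  by have [k [l [-> ->]]] := phiP a => /alpha_inj[-> ->].
apply: (@least_group_quotient_antiiso _ _ phi) => [a b|x|a b].
- have [g [h va]] := v_alpha a; have [k [l vb]] := v_alpha b.
  (* The factor [Order.max h k] begins both parameters of the product, hence cancels in its
     image. *)
  have := vM a b; rewrite va vb alphaM => /phiE ->.
  by rewrite (phiE _ _ _ va) (phiE _ _ _ vb) !invgM invgK !mulgA mulgVK.
(* Preimages with parameters at least [1]: [alpha 1 x] if [1 <= x], and [alpha x^-1 1] otherwise. *)
- have [x1|/ltW x1] := leP 1 x.
    by have [a /phiE va] := alpha_v (lexx 1) x1; exists a;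
      rewrite va invg1 mul1g.
  have x1' : 1 <= x^-1 by rewrite -(leg_mulrE x) mul1g mulVg.
  by have [a /phiE va] := alpha_v x1' (lexx 1); exists a;
    rewrite va invgK mulg1.
have [g [h va]] := v_alpha a; have [k [l vb]] := v_alpha b.
rewrite (phiE _ _ _ va) (phiE _ _ _ vb) => /(congr1 inv).
rewrite !invgM !invgK => hgE.
(* Since [m] dominates [h] and [l], multiplying by [alpha m m] yields [alpha (m * h^-1 * g) m] and
   [alpha (m * l^-1 * k) m], which agree by [hgE]. The bound [1 <= m] puts [alpha m m] in the image
   of [v]. *)
pose m := Order.max 1 (Order.max h l).
have m1 : 1 <= m by rewrite le_max lexx.
have [e ve] := alpha_v m1 m1; exists e; apply: v_inj.
have hm : Order.max h m = m by apply/max_idPr; rewrite !le_max lexx !orbT.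
have lm : Order.max l m = m by apply/max_idPr; rewrite !le_max lexx !orbT.
by rewrite !vM va vb ve !alphaM hm lm -!mulgA hgE.
Qed.
End PartialShifts.

Theorem theorem3p10 (d : Order.disp_t) (G : logroupType d) :
  (forall C : congruence (bicyclic G), least_group_congruence C ->
     antiisomorphic (quotient_semigroup C) G) /\
  (forall C : congruence (bicyclic_pos G), least_group_congruence C ->
     antiisomorphic (quotient_semigroup C) G).
Proof.
split=> C.
  apply: (@shifts_least_group_quotient d G _ val val_inj) => [a b||].
  - exact: valM.
  - by move=> [f /= /asboolP].
  - move=> g h _ _.
    have gh : alpha g h \in @bicyclic_pred d G by apply/asboolP; exists g, h.
    by exists (Bicyclic gh).
apply: (@shifts_least_group_quotient d G _ val val_inj) => [a b||].
- exact: valM.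
- by move=> [f /= /asboolP[g [h [_ _ ->]]]]; exists g, h.
- move=> g h g1 h1.
  have gh : alpha g h \in @bicyclic_pos_pred d G by apply/asboolP; exists g, h.
  by exists (BicyclicPos gh).
Qed.
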